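(* Let $(C_0,C,\Gamma_1,\Gamma_2)$ be an associative BD-structure on a completely ordered finite set $S$, with $N=|S|$. This structure (together with the complete order) is obtained, up to isomorphism of completely ordered sets with associative BD-structure, by the matrix construction described in the context from some integer $N\times n$-matrix $(m^j_i)$ satisfying conditions (a) and (b) of the context (for some $n$) if and only if $\alpha_0\notin\Gamma_2$ and $C=C_0^k$ for some $k\in\mathbb{Z}$ (relatively prime to $N=|S|$).
   Context: A transitive cyclic permutation of a finite set $S$ is one acting as a single $|S|$-cycle; $\Gamma_{C_0}=\{(s,C_0(s)): s\in S\}$. An associative BD-structure on $S$ is $(C_0,C,\Gamma_1,\Gamma_2)$, with $C_0,C$ transitive cyclic permutations of $S$ and $\Gamma_1,\Gamma_2\subset\Gamma_{C_0}$ proper subsets such that $(C\times C)(\Gamma_1)=\Gamma_2$. A complete (i.e. total) order on $S$ is compatible with $C_0$ if $C_0$ takes every non-maximal element to the next element in this order; then $\alpha_0=(s_{\max},s_{\min})\in\Gamma_{C_0}$, where $s_{\min},s_{\max}$ are the minimal and maximal elements. An associative BD-structure on a completely ordered set $S$ is an associative BD-structure on $S$ such that the order is compatible with $C_0$. Matrices. Let $(m^j_i)$, $i\in\mathbb{Z}/N\mathbb{Z}$, $j=0,\ldots,n-1$, be a matrix of integers, extended to all $j\in\mathbb{Z}$ by the rule $m^{j+n}_i=m^j_{i-1}$. The conditions are: (a) the differences $m^j_i-m^j_{i'}$ (for $i,i'\in\mathbb{Z}/N\mathbb{Z}$) take values only in $\{-1,0,1\}$; (b) for all $i\ne i'$ in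 $\mathbb{Z}/N\mathbb{Z}$ the periodic infinite sequence $(m^j_i-m^j_{i'})_{j\in\mathbb{Z}}$ is not identically $0$, and the occurrences of $1$ and $-1$ in it alternate. Construction. Given such a matrix, equip the set $\{1,\ldots,N\}=\mathbb{Z}/N\mathbb{Z}$ with the complete order $\prec$: $i\prec i'$ if either $m^0_i<m^0_{i'}$, or $m^0_i=m^0_{i'}$ and the first nonzero term in the sequence $(m^j_i-m^j_{i'})$, $j=0,1,\ldots$, is negative. Let $C_0$ be the transitive cyclic permutation compatible with $\prec$, let $C(i)=i-1$, let $$P_1=\{(i,i') : i\neq i',\ m^j_i=m^j_{i'}\text{ for }0<j<n,\text{ and }C(i)\prec C(i')\},$$ and put $\Gamma_1=P_1\cap\Gamma_{C_0}$, $\Gamma_2=(C\times C)(\Gamma_1)$. These data form an associative BD-structure on the completely ordered set $(\{1,\ldots,N\},\prec)$. *)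

(* Defs.v *)
From HB Require Import structures.
From mathcomp Require Import all_boot all_order all_algebra all_fingroup.

Set Implicit Arguments.
Unset Strict Implicit.
Unset Printing Implicit Defensive.

Import Order.TTheory GRing.Theory Num.Theory.
Local Open Scope ring_scope.

Definition perm_expz (T : finType) (s : {perm T}) (k : int) : {perm T} :=
  match k with
  | Posz n => (s ^+ n)%g
  | Negz n => (s ^- n.+1)%g
  end.

Lemma perm_expzS (T : finType) (s : {perm T}) (k : int) :
  perm_expz s (k + 1) = (s * perm_expz s k)%g.
Proof.
case: k => [n|[|n]].
- have -> : Posz n + 1 = Posz n.+1 by rewrite -addn1 PoszD.
  by rewrite /= expgS.
- by rewrite /= expg1 mulgV.
- have -> : Negz n.+1 + 1 = Negz n.
    by rewrite !NegzE -[n.+2]addn1 PoszD opprD addrNK.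
  by rewrite /= [(s ^+ n.+2)%g]expgSr invMg mulgA mulgV mul1g.
Qed.

(** * Associative BD-structures *)

Definition transitive_cyclic (S : finType) (s : {perm S}) : Prop :=
  forall x : S, porbit s x = [set: S].

Definition perm_graph (S : finType) (s : {perm S}) : {set S * S} :=
  [set (x, s x) | x : S].

Record bd_data (S : finType) := BDData {
  bd_C0 : {perm S};
  bd_C  : {perm S};
  bd_G1 : {set S * S};
  bd_G2 : {set S * S}
}.

Definition assoc_bd (S : finType) (B : bd_data S) : Prop :=
  [/\ transitive_cyclic (bd_C0 B),
      transitive_cyclic (bd_C B),
      bd_G1 B \proper perm_graph (bd_C0 B),
      bd_G2 B \proper perm_graph (bd_C0 B)
    & [set (bd_C B p.1, bd_C B p.2) | p in bd_G1 B] = bd_G2 B].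

(* [lt] is the strict part of a complete (total) order. *)
Definition compatible (S : finType) (lt : S -> S -> Prop) (s : {perm S}) : Prop :=
  forall x : S, (exists y, lt x y) ->
    lt x (s x) /\ (forall y, lt x y -> y = s x \/ lt (s x) y).

Definition ordered_bd_iso (S T : finType)
    (ltS : S -> S -> Prop) (A : bd_data S)
    (ltT : T -> T -> Prop) (B : bd_data T) : Prop :=
  exists f : S -> T,
  [/\ bijective f,
      (forall x y, ltS x y <-> ltT (f x) (f y)),
      (forall x, f (bd_C0 A x) = bd_C0 B (f x)) /\
      (forall x, f (bd_C A x) = bd_C B (f x)),
      [set (f p.1, f p.2) | p in bd_G1 A] = bd_G1 B
    & [set (f p.1, f p.2) | p in bd_G2 A] = bd_G2 B].

(** * The matrix construction *)

(* Z/NZ is ['I_N] with cyclic arithmetic rather than ['Z_N], because ['Z_1] has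
   two elements.  Here [ord_predp N] is the permutation [i |-> i - 1]. *)
Definition ord_predp (N : nat) : {perm 'I_N} := perm (@ord_pred_inj N).

(* The extension of an N x n matrix (n written as [n.+1], since n >= 1) to
   columns indexed by all integers: if j = q n + r with 0 <= r < n, then
   m^j_i = m^r_(i - q). *)
Definition mx_ext (N n : nat) (m : 'M[int]_(N, n.+1)) (i : 'I_N) (j : int) : int :=
  m (perm_expz (ord_predp N) (j %/ n.+1)%Z i) (inord `|(j %% n.+1)%Z|%N).

Lemma mx_ext_base (N n : nat) (m : 'M[int]_(N, n.+1)) (i : 'I_N) (j : 'I_n.+1) :
  mx_ext m i (j : nat)%:Z = m i j.
Proof.
rewrite /mx_ext divz_nat modz_nat /= divn_small ?ltn_ord // modn_small ?ltn_ord //.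
by rewrite /= perm1 inord_val.
Qed.

Lemma mx_ext_period (N n : nat) (m : 'M[int]_(N, n.+1)) (i : 'I_N) (j : int) :
  mx_ext m i (j + n.+1%:Z) = mx_ext m (ord_pred i) j.
Proof.
rewrite /mx_ext modzDr divzDr ?dvdzz // divzz /= perm_expzS permM.
by rewrite [X in perm_expz _ _ X]permE.
Qed.

Definition mx_diff (N n : nat) (m : 'M[int]_(N, n.+1)) (i i' : 'I_N) (j : int) : int :=
  mx_ext m i j - mx_ext m i' j.

Definition pm1 (z : int) : bool := (z == 1) || (z == -1).

Definition alternating (d : int -> int) : Prop :=
  forall j k : int, j < k -> pm1 (d j) -> pm1 (d k) ->
    (forall l : int, j < l < k -> ~~ pm1 (d l)) -> d k = - d j.

Definition mx_cond_a (N n : nat) (m : 'M[int]_(N, n.+1)) : Prop :=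
  forall (i i' : 'I_N) (j : int),
    mx_diff m i i' j \in [:: -1; 0; 1].

Definition mx_cond_b (N n : nat) (m : 'M[int]_(N, n.+1)) : Prop :=
  forall i i' : 'I_N, i != i' ->
    ~ (forall j : int, mx_diff m i i' j = 0) /\ alternating (mx_diff m i i').

Definition mx_prec (N n : nat) (m : 'M[int]_(N, n.+1)) (i i' : 'I_N) : Prop :=
  mx_ext m i 0 < mx_ext m i' 0 \/
  mx_ext m i 0 = mx_ext m i' 0 /\
  exists j : nat, mx_diff m i i' j%:Z < 0 /\
    forall k : nat, (k < j)%N -> mx_diff m i i' k%:Z = 0.

Definition mx_P1 (N n : nat) (m : 'M[int]_(N, n.+1)) (i i' : 'I_N) : Prop :=
  [/\ i <> i',
      (forall j : int, 0 < j < n.+1%:Z -> mx_ext m i j = mx_ext m i' j)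
    & mx_prec m (ord_predp N i) (ord_predp N i')].

(* These clauses determine [B] uniquely when [m] satisfies [mx_cond_a] and
   [mx_cond_b]: the first two characterize the transitive cyclic permutation
   compatible with the total order [mx_prec m]. *)
Definition mx_construction (N n : nat) (m : 'M[int]_(N, n.+1))
    (B : bd_data 'I_N) : Prop :=
  [/\ transitive_cyclic (bd_C0 B),
      compatible (mx_prec m) (bd_C0 B),
      bd_C B = ord_predp N,
      (forall i i' : 'I_N, (i, i') \in bd_G1 B <->
         mx_P1 m i i' /\ (i, i') \in perm_graph (bd_C0 B))
    & bd_G2 B = [set (bd_C B p.1, bd_C B p.2) | p in bd_G1 B]].

Definition obtained_from_matrix (S : finType) (lt : S -> S -> Prop)
    (A : bd_data S) : Prop :=
  exists (n : nat) (m : 'M[int]_(#|S|, n.+1)) (B : bd_data 'I_#|S|),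
    [/\ mx_cond_a m, mx_cond_b m, mx_construction m B
      & ordered_bd_iso lt A (mx_prec m) B].

(* Main.v *)
Require Import Defs.
From mathcomp Require Import all_boot all_order all_algebra all_fingroup.
From mathcomp Require Import zify.

(** The idea is that a column of a matrix satisfying (a) and (b) is nothing but
    a cut of a cyclic order, and that the whole matrix is a walk of the cut
    point around the circle.

    Let [<_j] be the lexicographic order on rows read from column [j] onwards;
    the order of the construction is [<_0], and [i <_(j+1 period) i'] means
    [C i <_0 C i'].  By (a), column [j] splits the rows into a low and a high
    level.  Going from [<_j] to [<_(j+1)] preserves the comparison of two rows
    on the same level, while by the alternation in (b) every high row, which was
    above every low row, falls below it.  So [<_(j+1)] is a rotation of [<_j]:
    the rank of each row drops by the number of low rows, modulo [N]
    ([rank_tail_next]).  After a full period this says that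
    [rank (C i) = rank i + k] modulo [N] for a constant [k], and since [C0]
    raises ranks by 1 modulo [N], [C = C0 ^ k]; transitivity of [C] makes [k] a
    unit modulo [N] ([matrix_rotation]).  The pair (max, min) is not in [Gamma2]
    because a pair of [P1] has its image under [C] in increasing order
    ([matrix_alpha0]).

    Conversely, identify [S] with the integers modulo [N] through the rank, so
    that [C0] is [x + 1] and [C] is [x + k].  Any sequence of cut points [a j]
    with [a (j + n) = a j - k] defines a matrix: the entry at [x] and [j] is 0
    when one meets [x] strictly before [a (j+1)] in walking upwards from [a j],
    and 1 otherwise.  Then [<_j] is the linear order obtained by opening the
    circle at [a j], which gives (a) and (b) as soon as [a] hits every residue;
    and a pair [(x, x + 1)] lies in [P1] exactly when none of [a 1, ..., a n]
    separates it, that is, equals [x + 1] ([cut_mx_P1]).  It remains to take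
    [a 0 = 0] and to let [a 1, ..., a n] run through the points [C0 x] with
    [(x, C0 x)] outside [Gamma1].  The last cut [a n = - k] is forced by the
    shift rule; it is [C^-1 min], and the pair that it separates is carried by
    [C] to (max, min), so that this cut is harmless precisely because
    (max, min) is not in [Gamma2] ([last_cut_mem]). *)

Import Order.TTheory GRing.Theory Num.Theory.

Set Implicit Arguments.
Unset Strict Implicit.
Unset Printing Implicit Defensive.

Local Open Scope ring_scope.

(** * Congruences and translations modulo N *)

Lemma eqmodzP (N a b : int) :
  (a = b %[mod N])%Z <-> exists q : int, a = b + q * N.
Proof.
split=> [/eqP | [q ->]]; last by rewrite addrC modzMDl.
by rewrite eqz_mod_dvd => /dvdzP[q e]; exists q; rewrite -e addrC subrK.
Qed.

Lemma eqmodz_small (N a b : int) :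
  0 <= a < N -> 0 <= b < N -> (a = b %[mod N])%Z -> a = b.
Proof. by move=> ha hb; rewrite !modz_small. Qed.

Section Translations.
Variables (T : finType) (N : int) (rho : T -> int).

Lemma translation_expz (s : {perm T}) (c : int) :
  (forall x, rho (s x) = rho x + c %[mod N])%Z ->
  forall (k : int) x, (rho (perm_expz s k x) = rho x + k * c %[mod N])%Z.
Proof.
move=> hs.
have hs' x : exists q, rho (s x) = rho x + c + q * N by apply/eqmodzP.
have pos n x : (rho ((s ^+ n)%g x) = rho x + n%:Z * c %[mod N])%Z.
  apply/eqmodzP; elim: n => [|n [q IH]]; first by exists 0; rewrite expg0 perm1; lia.
  have [q' e] := hs' ((s ^+ n)%g x).
  by exists (q + q'); rewrite expgSr permM e IH; lia.
case=> n x /=; first exact: pos.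
have /eqmodzP[q e] := pos n.+1 ((s ^- n.+1)%g x).
rewrite permKV in e; apply/eqmodzP; exists (- q); rewrite NegzE; lia.
Qed.

End Translations.

(** * Ranks in a finite ordered set *)

Section Rank.
Variables (d : Order.disp_t) (O : orderType d) (T : finType) (f : T -> O).
Hypothesis f_inj : injective f.

(** Orders enter through an injective key [f] with values in an ordered type, so
    that the given order on [S] and the orders read off a matrix from its various
    columns are all treated alike, on the same carrier. *)
Definition rank (x : T) : nat := #|[set y | (f y < f x)%O]|.

Lemma rank_lt_card x : (rank x < #|T|)%N.
Proof.
rewrite -cardsT; apply: proper_card; apply/properP; split; first exact: subsetT.
by exists x; rewrite ?inE // ltxx.
Qed.

Lemma rank_bounds x : 0 <= (rank x)%:Z < #|T|%:Z.
Proof. by have := rank_lt_card x; lia. Qed.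

Lemma ltn_rank x y : (rank x < rank y)%N = (f x < f y)%O.
Proof.
have up a b : (f a <= f b)%O -> (rank a <= rank b)%N.
  by move=> ab; apply: subset_leq_card; apply/subsetP=> z; rewrite !inE => /lt_le_trans->.
apply/idP/idP => [|xy].
  by apply: contraTT; rewrite -leNgt -leqNgt; apply: up.
apply: proper_card; apply/properP; split.
  by apply/subsetP=> z; rewrite !inE => /lt_trans->.
by exists x; rewrite !inE ?ltxx.
Qed.

Lemma rank_inj : injective rank.
Proof.
move=> x y e; apply: f_inj; apply: le_anti.
by rewrite !leNgt -!ltn_rank e ltnn.
Qed.

Lemma rank_mod_inj x y : ((rank x)%:Z = (rank y)%:Z %[mod #|T|%:Z])%Z -> x = y.
Proof. by move/(eqmodz_small (rank_bounds x) (rank_bounds y)) => [] /rank_inj. Qed.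

Lemma rank_surj r : (r < #|T|)%N -> exists x, rank x = r.
Proof.
move=> hr; pose g x := Ordinal (rank_lt_card x).
have g_inj : injective g by move=> x y [] /rank_inj.
have [|h _ hg] := inj_card_bij g_inj; first by rewrite card_ord.
by exists (h (Ordinal hr)); have /(congr1 val) := hg (Ordinal hr).
Qed.

Lemma rank_cover x y : (f x < f y)%O ->
  (forall z, (f x < f z)%O -> z = y \/ (f y < f z)%O) -> rank y = (rank x).+1.
Proof.
move=> xy cov; rewrite /rank.
have -> : [set z | (f z < f y)%O] = x |: [set z | (f z < f x)%O].
  apply/setP=> z; rewrite !inE; have [->|zx] := eqVneq z x; first by rewrite xy.
  apply/idP/idP=> [zy|/lt_trans->//]; rewrite ltNge; apply/negP=> xz.
  have /cov[e|/(lt_trans zy)] : (f x < f z)%O; last by rewrite ltxx.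
    by rewrite lt_neqAle xz andbT; apply: contraNneq zx => /f_inj ->.
  by rewrite e ltxx in zy.
by rewrite cardsU1 !inE ltxx.
Qed.

(** A compatible permutation is only prescribed off the maximal element; there
    injectivity leaves it no choice but the minimal one, so that it is cyclic
    translation of ranks. *)
Lemma rank_compatible (s : {perm T}) :
  compatible (fun x y => (f x < f y)%O) s ->
  forall x, ((rank (s x))%:Z = (rank x)%:Z + 1 %[mod #|T|%:Z])%Z.
Proof.
move=> hs.
have nonmax x : ((rank x).+1 < #|T|)%N -> rank (s x) = (rank x).+1.
  move=> /rank_surj[y ey]; have xy : (f x < f y)%O by rewrite -ltn_rank ey.
  by have [? ?] := hs x (ex_intro _ y xy); apply: rank_cover.
move=> x; have := rank_lt_card x; rewrite leq_eqVlt => /orP[/eqP max|/nonmax->].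
  (* the maximal element goes to the only rank that no other element reaches *)
  suff -> : rank (s x) = 0%N by rewrite -max -addn1 PoszD modzz mod0z.
  case e: (rank (s x)) => [//|r]; have /ltnW/rank_surj[p ep] : (r.+1 < #|T|)%N.
    by rewrite -e rank_lt_card.
  have /nonmax : ((rank p).+1 < #|T|)%N by rewrite ep -e rank_lt_card.
  rewrite ep -e => /rank_inj /perm_inj px.
  by have := rank_lt_card (s x); rewrite e -ep px max ltnn.
by rewrite -addn1 PoszD.
Qed.

Lemma rank_minimum x : (forall y, (f x <= f y)%O) -> rank x = 0%N.
Proof.
move=> hx; apply/eqP; rewrite cards_eq0; apply/eqP/setP=> y; rewrite !inE.
by apply/negbTE; rewrite -leNgt.
Qed.

End Rank.

Lemma eq_rank (d d' : Order.disp_t) (O : orderType d) (O' : orderType d')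
    (T : finType) (f : T -> O) (g : T -> O') :
  (forall x y, (f x < f y)%O = (g x < g y)%O) -> rank f =1 rank g.
Proof. by move=> h x; apply: eq_card => y; rewrite !inE h. Qed.

Lemma rank_perm (d : Order.disp_t) (O : orderType d) (T : finType)
    (f : T -> O) (s : {perm T}) x : rank (fun y => f (s y)) x = rank f (s x).
Proof.
rewrite /rank -(card_preimset [set y | (f y < f (s x))%O] (@perm_inj _ s)).
by apply: eq_card => y; rewrite !inE.
Qed.

(** * Lexicographic comparison of sequences *)

Definition lex_lt (u v : nat -> int) : Prop :=
  exists l : nat, u l < v l /\ forall k, (k < l)%N -> u k = v k.

Lemma lex_lt_asym u v : lex_lt u v -> ~ lex_lt v u.
Proof.
move=> [l [ul el]] [k [vk ek]]; case: (ltngtP k l) => kl.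
- by rewrite el // ltxx in vk.
- by rewrite ek // ltxx in ul.
- by rewrite kl in vk; have := lt_trans ul vk; rewrite ltxx.
Qed.

Lemma lex_lt_cons u v : u 0%N = v 0%N ->
  lex_lt u v <-> lex_lt (fun j => u j.+1) (fun j => v j.+1).
Proof.
move=> e0; split=> [[[|l] [ul el]]|[l [ul el]]].
- by rewrite e0 ltxx in ul.
- by exists l; split=> // k kl; apply: el.
- by exists l.+1; split=> // -[//|k] kl; apply: el.
Qed.

Lemma mx_precE (N n : nat) (m : 'M[int]_(N, n.+1)) i i' :
  mx_prec m i i' <-> lex_lt (fun j => mx_ext m i j%:Z) (fun j => mx_ext m i' j%:Z).
Proof.
have dE j : (mx_diff m i i' j < 0) = (mx_ext m i j < mx_ext m i' j).
  by rewrite subr_lt0.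
split=> [[lt0|[e0 [j [dj ej]]]]|[[|l] [ul el]]].
- by exists 0%N.
- exists j; split; first by rewrite -dE.
  by move=> k kj; apply/eqP; rewrite -subr_eq0; apply/eqP; exact: ej.
- by left.
- right; split; first exact: (el 0%N).
  exists l.+1; rewrite dE; split=> // k kl; apply/eqP; rewrite subr_eq0; apply/eqP; exact: el.
Qed.

(** Lists ordered lexicographically supply totality and transitivity of the
    comparison of rows for free; this links them to the first difference. *)
Lemma lexi_map_ltP (u v : nat -> int) (j M : nat) :
  reflect (exists l, [/\ (l < M)%N, u (j + l)%N < v (j + l)%N
             & forall k, (k < l)%N -> u (j + k)%N = v (j + k)%N])
    (([seq u k | k <- iota j M] : seqlexi int) < [seq v k | k <- iota j M])%O.
Proof.
elim: M j => [|M IH] j /=; first by rewrite ltxx; constructor=> -[l []].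
rewrite ltxi_cons; case: (ltgtP (u j) (v j)) => [lt|gt|e] /=.
- by constructor; exists 0%N; rewrite addn0.
- constructor; case=> -[|l] []; rewrite ?addn0 => _ lt el.
    by have := lt_trans lt gt; rewrite ltxx.
  by have := el 0%N erefl; rewrite addn0 => e; rewrite e ltxx in gt.
- apply/(equivP (IH j.+1)); split=> [[l [lM lt el]]|[[|l] [lM lt el]]].
  + exists l.+1; rewrite addnS -addSn; split=> // -[|k] kl; first by rewrite addn0.
    by rewrite addnS -addSn; apply: el.
  + by rewrite addn0 e ltxx in lt.
  + by exists l; rewrite addSnnS; split=> // k kl; rewrite addSnnS; apply: el.
Qed.

(** * Alternating families of sequences *)

Section AlternatingSequences.
Variables (T : finType) (w : T -> nat -> int) (L : nat).
Hypothesis two_levels : forall x y j, w x j <= w y j + 1.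
Hypothesis alternate : forall x y j k, (j < k)%N -> w x j < w y j ->
  (forall l, (j < l < k)%N -> w x l = w y l) -> w y k <= w x k.
Hypothesis separate : forall x y j, x != y ->
  exists l, (l < L)%N /\ w x (j + l)%N <> w y (j + l)%N.

(** By [separate], a window of length [L] decides every comparison, so that
    [tail j] is a key for the lexicographic order from index [j] onwards. *)
Definition tail (j : nat) (x : T) : seqlexi int := [seq w x k | k <- iota j L].

Lemma tail_ltP j x y :
  (tail j x < tail j y)%O <-> lex_lt (fun l => w x (j + l)%N) (fun l => w y (j + l)%N).
Proof.
split=> [/lexi_map_ltP[l [_ lt el]]|[l [lt el]]]; first by exists l.
apply/lexi_map_ltP; exists l; split=> //; rewrite ltnNge; apply/negP=> Ll.
have /(separate j)[k [kL []]] : x != y by apply: contraTneq lt => ->; rewrite ltxx.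
exact: el (leq_trans kL Ll).
Qed.

Lemma tail_inj j : injective (tail j).
Proof.
move=> x y e; apply/eqP/negP=> /negP/(separate j)[l [lL]]; case.
move/(congr1 (fun s : seq int => nth 0 s l)): e.
by rewrite !(nth_map 0%N) ?size_iota // nth_iota.
Qed.

Lemma tail_lt_next j x y : w x j = w y j ->
  (tail j x < tail j y)%O = (tail j.+1 x < tail j.+1 y)%O.
Proof.
move=> e; apply/idP/idP=> /tail_ltP h; apply/tail_ltP.
  case/(@lex_lt_cons (fun l => w x (j + l)%N) (fun l => w y (j + l)%N)): h.
    by rewrite addn0.
  move=> l [lt el]; exists l; rewrite addSnnS; split=> // k /el; by rewrite addSnnS.
apply/(@lex_lt_cons (fun l => w x (j + l)%N) (fun l => w y (j + l)%N)).
  by rewrite addn0.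
by case: h => l [lt el]; exists l; rewrite -addSnnS; split=> // k /el; rewrite -addSnnS.
Qed.

(** The only place where alternation matters: the first difference after [j] has
    the sign opposite to the one at [j], so that the comparison flips. *)
Lemma tail_lt_swap j x y : w x j < w y j ->
  (tail j x < tail j y)%O /\ (tail j.+1 y < tail j.+1 x)%O.
Proof.
move=> lt; split; first by apply/tail_ltP; exists 0%N; rewrite addn0.
have xy : y != x by apply: contraTneq lt => ->; rewrite ltxx.
rewrite lt_neqAle (inj_eq (@tail_inj _)) xy leNgt; apply/negP=> /tail_ltP[l [ltl el]].
suff : w y (j.+1 + l)%N <= w x (j.+1 + l)%N by rewrite leNgt ltl.
apply: (alternate _ lt); first lia.
by move=> k kl; have := el (k - j.+1)%N; rewrite subnKC; [apply|]; lia.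
Qed.

(** At index [j] the low elements are an initial segment of the order from [j],
    and become a final segment of the order from [j + 1], each level keeping its
    internal order: this is a rotation, by the number of low elements. *)
Lemma rank_tail_next j :
  exists c : int, forall x, ((rank (tail j.+1) x)%:Z = (rank (tail j) x)%:Z - c %[mod #|T|%:Z])%Z.
Proof.
pose Low := [set y | [exists z, w y j < w z j]].
have lowP y : reflect (exists z, w y j < w z j) (y \in Low) by rewrite inE; apply: existsP.
have low_high x y : x \in Low -> y \notin Low -> w x j < w y j.
  move=> /lowP[z xz] /lowP ny; apply: lt_le_trans xz _; rewrite leNgt.
  by apply/negP=> yz; case: ny; exists z.
have lowE x y : x \in Low -> y \in Low -> w x j = w y j.
  move=> /lowP[z xz] /lowP[t yt].
  by have := two_levels z y j; have := two_levels t x j; lia.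
have highE x y : x \notin Low -> y \notin Low -> w x j = w y j.
  move=> /lowP nx /lowP ny; case: (ltgtP (w x j) (w y j)) => // h.
    by case: nx; exists y.
  by case: ny; exists x.
exists #|Low|%:Z => x; apply/eqmodzP.
have [xl|xh] := boolP (x \in Low).
  (* a low element gains all the high ones as predecessors *)
  exists 1; have -> : rank (tail j.+1) x = (rank (tail j) x + #|~: Low|)%N.
    rewrite /rank -cardsUI [X in (_ + X)%N](_ : _ = 0%N) ?addn0.
      apply: eq_card => y; rewrite inE in_setU in_setC inE.
      have [yl|yh] := boolP (y \in Low).
        by rewrite orbF; apply/esym/tail_lt_next/lowE.
      rewrite orbT.
      by have [_ ->] := tail_lt_swap (low_high _ _ xl yh).
    apply/eqP; rewrite cards_eq0; apply/eqP/setP=> y; rewrite !in_setI in_setC in_set0 inE.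
    apply/negbTE/negP=> /andP[yx yh].
    have [xy _] : (tail j x < tail j y)%O /\ (tail j.+1 y < tail j.+1 x)%O.
      exact/tail_lt_swap/low_high.
    by have := lt_trans xy yx; rewrite ltxx.
  by have := cardsC Low; lia.
(* a high element loses all the low ones *)
exists 0; have -> : rank (tail j) x = (rank (tail j.+1) x + #|Low|)%N; last lia.
rewrite /rank -cardsUI [X in (_ + X)%N](_ : _ = 0%N) ?addn0.
  apply: eq_card => y; rewrite inE in_setU inE.
  have [yl|yh] := boolP (y \in Low).
    by rewrite orbT; have [->] := tail_lt_swap (low_high _ _ yl xh).
  by rewrite orbF; apply/tail_lt_next/highE.
apply/eqP; rewrite cards_eq0; apply/eqP/setP=> y; rewrite in_setI in_set0 inE.
apply/negbTE/negP=> /andP[yx yl].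
have [_ xy] := tail_lt_swap (low_high _ _ yl xh).
by have := lt_trans xy yx; rewrite ltxx.
Qed.

Lemma rank_tail j :
  exists c : int, forall x, ((rank (tail j) x)%:Z = (rank (tail 0) x)%:Z - c %[mod #|T|%:Z])%Z.
Proof.
elim: j => [|j [c IH]]; first by exists 0 => x; rewrite subr0.
have [c' h] := rank_tail_next j; exists (c + c') => x.
have /eqmodzP[q e] := IH x; have /eqmodzP[q' e'] := h x.
by apply/eqmodzP; exists (q + q'); lia.
Qed.

End AlternatingSequences.

(** * Periodicity and order of the extended matrix *)

Lemma ord_predp_mod (N : nat) (q : int) (i : 'I_N) :
  ((perm_expz (ord_predp N) q i : nat)%:Z = (i : nat)%:Z - q %[mod N%:Z])%Z.
Proof.
rewrite -[- q]mulrN1.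
apply: (translation_expz (rho := fun i : 'I_N => (i : nat)%:Z)) => {}i.
rewrite permE /= -modz_nat modz_mod; apply/eqmodzP; exists 1.
by have := ltn_ord i; lia.
Qed.

Lemma ord_predp_expz_eq (N : nat) (p q : int) (i : 'I_N) :
  (p = q %[mod N%:Z])%Z -> perm_expz (ord_predp N) p i = perm_expz (ord_predp N) q i.
Proof.
move=> /eqmodzP[r e]; apply: val_inj; apply/eqP; rewrite -eqz_nat; apply/eqP.
apply: (@eqmodz_small N%:Z); rewrite ?ltz_nat ?ltn_ord //.
by rewrite !ord_predp_mod; apply/eqmodzP; exists (- r); lia.
Qed.

Lemma mx_ext_full_period (N n : nat) (m : 'M[int]_(N, n.+1)) i (j q : int) :
  mx_ext m i (j + q * (n.+1 * N)%N%:Z) = mx_ext m i j.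
Proof.
have e : j + q * (n.+1 * N)%N%:Z = (q * N%:Z) * n.+1%:Z + j by rewrite PoszM; lia.
rewrite /mx_ext e modzMDl divzMDl // (ord_predp_expz_eq (q := (j %/ n.+1)%Z)) //.
by rewrite modzMDl.
Qed.

Section MatrixOrder.
Variables (N n : nat) (m : 'M[int]_(N, n.+1)).
Hypotheses (ma : mx_cond_a m) (mb : mx_cond_b m).

Lemma mx_two_levels i i' j : mx_ext m i j <= mx_ext m i' j + 1.
Proof. by have := ma i i' j; rewrite !inE /mx_diff; lia. Qed.

Lemma mx_alternate i i' (j k : nat) : (j < k)%N -> mx_ext m i j < mx_ext m i' j ->
  (forall l, (j < l < k)%N -> mx_ext m i l = mx_ext m i' l) -> mx_ext m i' k <= mx_ext m i k.
Proof.
move=> jk lt el; have [e|ii'] := eqVneq i i'; first by rewrite e ltxx in lt.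
rewrite leNgt; apply/negP=> ltk; have [_ /(_ j%:Z k%:Z)] := mb ii'.
have := ma i i' j; have := ma i i' k; rewrite !inE /mx_diff /pm1 => hk hj alt.
suff : mx_ext m i k - mx_ext m i' k = - (mx_ext m i j - mx_ext m i' j) by lia.
apply: alt; [lia|lia|lia|] => -[] l //; rewrite !ltz_nat => /el ->.
by rewrite subrr.
Qed.

(** The extended matrix is periodic in [j] with period [n.+1 * N], so that two
    rows that agree on a window of that length agree everywhere. *)
Lemma mx_separate i i' (j : nat) : i != i' ->
  exists l : nat, (l < n.+1 * N)%N /\ mx_ext m i (j + l)%N <> mx_ext m i' (j + l)%N.
Proof.
move=> ii'; set L := (n.+1 * N)%N.
have L0 : (0 < L)%N by rewrite muln_gt0 /= (leq_ltn_trans _ (ltn_ord i)).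
case: (boolP [forall l : 'I_L, mx_ext m i (j + l)%N == mx_ext m i' (j + l)%N]); last first.
  by case/forallPn=> l /eqP h; exists l.
move=> /forallP h; have [[]] := mb ii' => k; apply/eqP; rewrite subr_eq0.
have r_lt : (`|((k - j%:Z) %% L%:Z)%Z|%N < L)%N by lia.
have -> : k = (j + Ordinal r_lt)%N%:Z + ((k - j%:Z) %/ L%:Z)%Z * L%:Z.
  rewrite /= PoszD gez0_abs ?modz_ge0 //; last lia.
  by rewrite -addrA [(_ %% _)%Z + _]addrC -divz_eq addrC subrK.
by rewrite !mx_ext_full_period h.
Qed.

End MatrixOrder.

(** * Necessity *)

Section Necessity.
Variables (d : Order.disp_t) (S : finTBOrderType d) (A : bd_data S).

Lemma matrix_alpha0 : obtained_from_matrix (fun x y : S => (x < y)%O) A ->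
  ((\top, \bot)%O : S * S) \notin bd_G2 A.
Proof.
case=> n [m [B [_ _ [_ _ CE G1E G2E] [f [_ f_lt _ _ fG2]]]]]; apply/negP=> h.
have : (f \top, f \bot)%O \in bd_G2 B by rewrite -fG2; apply/imsetP; exists (\top, \bot)%O.
rewrite G2E => /imsetP[[i i'] /G1E[[_ _ ii'] _] /= [e e']].
by move: ii'; rewrite -CE -e -e' => /f_lt; rewrite ltx0.
Qed.

(** Reading rows from column [n.+1] instead of column 0 amounts to applying
    [C]; the ranks of the two orders differ by a constant modulo the cardinal of
    [S], which is how [C] becomes a translation, hence a power of [C0]. *)
Lemma matrix_rotation (hC : transitive_cyclic (bd_C A))
    (hcompat : compatible (fun x y : S => (x < y)%O) (bd_C0 A)) :
  obtained_from_matrix (fun x y : S => (x < y)%O) A ->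
  exists k : int, coprimez k (Posz #|S|) /\ bd_C A = perm_expz (bd_C0 A) k.
Proof.
case=> n [m [B [ma mb [_ _ CE _ _] [f [f_bij f_lt [_ fC] _ _]]]]].
have f_inj := bij_inj f_bij.
pose w x (j : nat) := mx_ext m (f x) j%:Z.
pose L := (n.+1 * #|S|)%N.
have w2 x y j : w x j <= w y j + 1 by apply: mx_two_levels.
have walt x y j k : (j < k)%N -> w x j < w y j ->
  (forall l, (j < l < k)%N -> w x l = w y l) -> w y k <= w x k by apply: mx_alternate.
have wsep x y j : x != y -> exists l, (l < L)%N /\ w x (j + l)%N <> w y (j + l)%N.
  by move=> xy; apply: mx_separate => //; rewrite (inj_eq f_inj).
have wC x j : w (bd_C A x) j = w x (j + n.+1)%N.
  by rewrite /w PoszD mx_ext_period fC CE permE.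
have ltE x y : (x < y)%O = (tail w L 0 x < tail w L 0 y)%O.
  apply/idP/idP=> [/f_lt/mx_precE|] h.
    exact/(tail_ltP wsep 0).
  exact/f_lt/mx_precE/(tail_ltP wsep 0 x y).
pose rho (x : S) : int := (rank (fun y : S => y) x)%:Z.
have [c hc] := rank_tail w2 walt wsep n.+1.
have rhoC x : (rho (bd_C A x) = rho x - c %[mod #|S|%:Z])%Z.
  rewrite /rho !(eq_rank ltE) -hc -rank_perm; congr (modz _ _); congr Posz.
  apply: eq_rank => {}x y; suff tailC z : tail w L 0 (bd_C A z) = tail w L n.+1 z by rewrite !tailC.
  rewrite /tail -[n.+1]addn0 iotaDl -map_comp; apply: eq_map => j /=.
  by rewrite wC addnC.
have rhoC0 x : (rho (bd_C0 A x) = rho x + 1 %[mod #|S|%:Z])%Z by exact: rank_compatible.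
have rho_inj x y : (rho x = rho y %[mod #|S|%:Z])%Z -> x = y by apply: rank_mod_inj.
exists (- c); split; last first.
  by apply/permP=> x; apply: rho_inj; rewrite (translation_expz rhoC0) mulr1.
(* some power of [C] acts on the minimum as [C0], that is, as translation by 1 *)
have [q /(congr1 rho) e] : exists q, bd_C0 A \bot%O = (bd_C A ^+ q)%g \bot%O.
  by apply/porbitP; rewrite hC.
have /eqmodzP[a ea] := translation_expz rhoC q%:Z \bot%O.
have /eqmodzP[b eb] := rhoC0 \bot%O.
by apply/coprimezP; exists (q%:Z, a - b) => /=; move: ea; rewrite /= -e eb;
  move: (rho _) (Posz #|S|) => r M h; clear -h; lia.
Qed.

End Necessity.

(** * Cuts of a cyclic order *)

Section Cuts.
Variables (N : int) (a : int -> int).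
(** The number of steps upwards from the cut point [a j] to [r] on the circle of
    length [N]; comparing positions is the linear order opened at [a j]. *)
Definition cut_pos (j r : int) : int := ((r - a j) %% N)%Z.

(** When the cut does not move, that is, [a (j + 1) = a j] modulo [N], every
    point is on the high level, and the column is constant. *)
Definition cut_level (j r : int) : bool := cut_pos j (a (j + 1)) <= cut_pos j r.

Lemma cut_pos_eq j r s : (cut_pos j r == cut_pos j s) = (r == s %[mod N])%Z.
Proof.
apply/eqP/eqP=> /eqmodzP[q e]; apply/eqmodzP; exists q; lia.
Qed.

Hypothesis N_gt0 : 0 < N.

Lemma cut_pos_bounds j r : 0 <= cut_pos j r < N.
Proof. by rewrite modz_ge0 ?ltz_pmod //; lia. Qed.

Lemma cut_pos_next j r :
  cut_pos (j + 1) r =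
    cut_pos j r - cut_pos j (a (j + 1)) + (if cut_level j r then 0 else N).
Proof.
have := cut_pos_bounds j r; have := cut_pos_bounds j (a (j + 1)).
have eu : r - a j = ((r - a j) %/ N)%Z * N + cut_pos j r := divz_eq _ _.
have ev : a (j + 1) - a j = ((a (j + 1) - a j) %/ N)%Z * N + cut_pos j (a (j + 1))
  := divz_eq _ _.
rewrite /cut_level; move: eu ev.
move: (cut_pos j r) (cut_pos j (a (j + 1))).
move: ((r - a j) %/ N)%Z ((a (j + 1) - a j) %/ N)%Z => u v p t eu ev ht hp.
have e s : r - a (j + 1) = (u - v - s) * N + (p - t + s * N) by clear -eu ev; lia.
case: leP => tp; rewrite /cut_pos.
  by rewrite (e 0) modzMDl modz_small; clear -tp ht hp; lia.
by rewrite (e 1) modzMDl modz_small; clear -tp ht hp; lia.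
Qed.

Lemma cut_level_eq j r s : cut_level j r = cut_level j s ->
  (cut_pos (j + 1) r < cut_pos (j + 1) s) = (cut_pos j r < cut_pos j s).
Proof. by rewrite !cut_pos_next => ->; lia. Qed.

Lemma cut_level_lt j r s : ~~ cut_level j r -> cut_level j s ->
  cut_pos j r < cut_pos j s /\ cut_pos (j + 1) s < cut_pos (j + 1) r.
Proof.
rewrite !cut_pos_next => lr ls; rewrite (negbTE lr) ls.
have := cut_pos_bounds j r; have := cut_pos_bounds j s.
by move: lr ls; rewrite /cut_level; lia.
Qed.

(** The order can only change when two levels differ, which will give both the
    alternation and, since the cuts hit every point, the separation of rows. *)
Lemma cut_order_stable j (n : nat) r s :
  (forall l : nat, (l < n)%N -> cut_level (j + l%:Z) r = cut_level (j + l%:Z) s) ->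
  (cut_pos (j + n%:Z) r < cut_pos (j + n%:Z) s) = (cut_pos j r < cut_pos j s).
Proof.
elim: n => [|n IH] h; first by rewrite addr0.
rewrite -addn1 PoszD addrA cut_level_eq ?h // IH // => l ln; apply: h; lia.
Qed.

(** When the cut reaches [s], this point becomes the minimum, so that a point
    initially below it must have been overtaken: by [cut_level_lt], the first
    time that the levels differ, the lower point is on the lower level. *)
Lemma cut_first_change (J : nat) r s :
  cut_pos 0 r < cut_pos 0 s -> (a J%:Z = s %[mod N])%Z ->
  lex_lt (fun j => (cut_level j%:Z r)%:Z) (fun j => (cut_level j%:Z s)%:Z).
Proof.
move=> lt0 aJ.
have [|] := boolP [exists l : 'I_J, cut_level (l : nat)%:Z r != cut_level (l : nat)%:Z s].
  move=> /existsP[l0 hl0].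
  have ex : exists l : nat, cut_level l%:Z r != cut_level l%:Z s by exists l0.
  case: (ex_minnP ex) => l hl lmin.
  have stable k : (k < l)%N -> cut_level k%:Z r = cut_level k%:Z s.
    by move=> kl; apply/eqP; apply: contraLR kl => /lmin; rewrite -leqNgt.
  exists l; split=> [|k /stable -> //].
  have ltl : cut_pos l%:Z r < cut_pos l%:Z s.
    have := @cut_order_stable 0 l r s; rewrite add0r lt0 => -> //.
  case: (boolP (cut_level l%:Z r)) (boolP (cut_level l%:Z s)) hl => lr [] ls // _.
  by have [] := cut_level_lt ls lr; lia.
rewrite negb_exists => /forallP h.
have := @cut_order_stable 0 J r s; rewrite add0r lt0 => ltJ.
have aJ0 : cut_pos J%:Z s = 0.
  by have /eqmodzP[q ->] := esym aJ; rewrite /cut_pos addrAC subrr add0r modzMl.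
have := cut_pos_bounds J%:Z r; rewrite -aJ0 leNgt ltJ // => l lJ.
by have := h (Ordinal lJ); rewrite negbK => /eqP; rewrite add0r.
Qed.

End Cuts.

(** * The matrix of a periodic sequence of cuts *)

Section CutMatrix.
Variables (N n : nat) (a : int -> int) (k : int) (rho : 'I_N -> int).
Hypothesis a_shift : forall j q, a (j + q * n.+1%:Z) = a j - q * k.
Hypothesis rho_pred : forall i, (rho (ord_predp N i) = rho i + k %[mod N%:Z])%Z.

(** The hypotheses say that the cut recedes by [k] over one period, while moving
    to the previous row advances the coordinate by [k]; the relative position is
    the same, so that the extended matrix follows the cut for all [j]. *)
Definition cut_mx : 'M[int]_(N, n.+1) :=
  \matrix_(i, j) (cut_level N a (j : nat)%:Z (rho i))%:Z.

Lemma cut_mx_ext i j : mx_ext cut_mx i j = (cut_level N a j (rho i))%:Z.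
Proof.
rewrite /mx_ext mxE; set q := (j %/ _)%Z; set r := (j %% _)%Z.
have r_ge0 : 0 <= r by rewrite modz_ge0.
have r_lt : r < n.+1%:Z by rewrite ltz_pmod.
have -> : (inord `|r|%N : 'I_n.+1) = `|r|%N :> nat by rewrite inordK //; lia.
rewrite gez0_abs // [in RHS](divz_eq j n.+1%:Z) -/q -/r [q * _ + _]addrC.
have /eqmodzP[t ->] := translation_expz rho_pred q i.
rewrite /cut_level /cut_pos [r + _ + 1]addrAC !a_shift.
rewrite (_ : rho i + q * k + t * N - a r = t * N%:Z + (rho i - (a r - q * k))); last lia.
by rewrite modzMDl (_ : a (r + 1) - a r = a (r + 1) - q * k - (a r - q * k)); last lia.
Qed.

Lemma cut_mx_cond_a : mx_cond_a cut_mx.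
Proof.
move=> i i' j; rewrite /mx_diff !cut_mx_ext !inE.
by case: (cut_level _ _ _ (rho i)); case: cut_level.
Qed.

Hypothesis a0 : a 0 = 0.
Hypothesis rho_bounds : forall i, 0 <= rho i < N%:Z.
Hypothesis rho_inj : injective rho.
Hypothesis a_reaches : forall i, exists J : nat, (a J%:Z = rho i %[mod N%:Z])%Z.

Lemma ord_card_gt0 (i : 'I_N) : 0 < N%:Z.
Proof. by rewrite ltz_nat (leq_ltn_trans _ (ltn_ord i)). Qed.

Lemma cut_pos0 i : cut_pos N a 0 (rho i) = rho i.
Proof. by rewrite /cut_pos a0 subr0 modz_small. Qed.

Lemma rho_mod_inj i i' : (rho i = rho i' %[mod N%:Z])%Z -> i = i'.
Proof. by move/(eqmodz_small (rho_bounds i) (rho_bounds i'))/rho_inj. Qed.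

Lemma cut_mx_lex i i' : rho i < rho i' ->
  lex_lt (fun j => mx_ext cut_mx i j%:Z) (fun j => mx_ext cut_mx i' j%:Z).
Proof.
move=> lt; have [J aJ] := a_reaches i'.
have [|l [ltl el]] := @cut_first_change N%:Z a (ord_card_gt0 i) J (rho i) (rho i') _ aJ.
  by rewrite !cut_pos0.
by exists l; rewrite !cut_mx_ext; split=> // q /el; rewrite !cut_mx_ext.
Qed.

Lemma cut_mx_prec i i' : mx_prec cut_mx i i' <-> rho i < rho i'.
Proof.
split=> [|/cut_mx_lex h]; last exact/mx_precE.
move=> /mx_precE h; rewrite ltNge le_eqVlt; apply/negP=> /orP[/eqP/rho_inj e|/cut_mx_lex].
  by rewrite e in h; exact: (lex_lt_asym h h).
exact: lex_lt_asym.
Qed.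

Lemma cut_mx_cond_b : mx_cond_b cut_mx.
Proof.
move=> i i' ii'; have N0 := ord_card_gt0 i; split=> [h|j l jl].
  have no_lt u v : (forall j, mx_ext cut_mx u j = mx_ext cut_mx v j) -> ~ (rho u < rho v).
    by move=> e /cut_mx_lex[t []]; rewrite e ltxx.
  have e j : mx_ext cut_mx i j = mx_ext cut_mx i' j.
    by apply/eqP; rewrite -subr_eq0; apply/eqP; exact: h.
  have : rho i != rho i' by rewrite (inj_eq rho_inj).
  by rewrite neq_lt => /orP[] /no_lt; apply.
rewrite /mx_diff !cut_mx_ext => pj pl between.
have stable r s :
    (forall t, j < t < l -> cut_level N a t r = cut_level N a t s) ->
    (cut_pos N a l r < cut_pos N a l s) = (cut_pos N a (j + 1) r < cut_pos N a (j + 1) s).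
  move=> h; have -> : l = j + 1 + `|(l - (j + 1))%R|%N%:Z by lia.
  by apply: cut_order_stable => // t ht; apply: h; lia.
have eq_between t : j < t < l -> cut_level N a t (rho i) = cut_level N a t (rho i').
  move=> /between; rewrite /mx_diff !cut_mx_ext.
  by case: (cut_level _ _ _ (rho i)); case: cut_level.
have := stable (rho i) (rho i') eq_between.
have := stable (rho i') (rho i) (fun t ht => esym (eq_between t ht)).
have swap t r s := @cut_level_lt N%:Z a N0 t r s.
move: (swap j (rho i) (rho i')) (swap j (rho i') (rho i)).
move: (swap l (rho i) (rho i')) (swap l (rho i') (rho i)).
(* equal nonzero differences at [j] and [l] would make the points compare in
   one way just after [j] and in the other way at [l] *)
move: pj pl; rewrite /pm1.
case: (cut_level _ _ j (rho i)); case: (cut_level _ _ j (rho i')) => //;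
case: (cut_level _ _ l (rho i)); case: (cut_level _ _ l (rho i')) => //= _ _;
  move=> h1 h2 h3 h4 e1 e2.
all: try by case: (h1 erefl erefl); case: (h4 erefl erefl); lia.
all: try by case: (h2 erefl erefl); case: (h3 erefl erefl); lia.
all: try by case: (h1 erefl erefl); case: (h3 erefl erefl); lia.
all: by case: (h2 erefl erefl); case: (h4 erefl erefl); lia.
Qed.

Lemma cut_pos_last i : cut_pos N a n.+1%:Z (rho i) = rho (ord_predp N i).
Proof.
rewrite -[RHS](modz_small (rho_bounds _)) rho_pred /cut_pos.
by have := a_shift 0 1; rewrite add0r !mul1r a0 => ->; rewrite sub0r opprK.
Qed.

(** Two cyclic neighbours stay adjacent, in increasing order, in every order
    [<_j] except the ones opened between them.  A cut between them after column
    0 puts [i'] below [i], and agreement of the later columns would keep it there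
    until column [n.+1]. *)
Lemma cut_mx_P1 i i' : (rho i' = rho i + 1 %[mod N%:Z])%Z ->
  mx_P1 cut_mx i i' <->
  forall j : nat, (0 < j <= n.+1)%N -> (a j%:Z <> rho i' %[mod N%:Z])%Z.
Proof.
move=> next; have N0 := ord_card_gt0 i.
have pos_eq0 j : (a j = rho i' %[mod N%:Z])%Z <-> cut_pos N a j (rho i') = 0.
  rewrite /cut_pos; split=> [/eqmodzP[q ->]|e].
    by rewrite opprD addNKr -mulNr modzMl.
  by apply/esym/eqP; rewrite eqz_mod_dvd; apply/dvdz_mod0P.
split=> [[ii' eq_cols /cut_mx_prec] |avoid].
  rewrite -!cut_pos_last => lt j jn /pos_eq0 j0.
  have : cut_pos N a j%:Z (rho i') < cut_pos N a j%:Z (rho i).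
    rewrite lt_neqAle {2}j0; have /andP[-> _] := cut_pos_bounds a N0 j%:Z (rho i).
    rewrite andbT eq_sym.
    by rewrite cut_pos_eq; apply/eqP=> /rho_mod_inj.
  rewrite -(@cut_order_stable _ _ N0 j%:Z (n.+1 - j)) => [|l hl].
    rewrite -PoszD subnKC; last by case/andP: jn.
    by move/(lt_trans lt); rewrite ltxx.
  have := eq_cols (j + l)%N%:Z; rewrite !cut_mx_ext PoszD.
  by case: cut_level; case: cut_level => //=; lia.
have pos_next j : (0 < j <= n.+1)%N ->
    cut_pos N a j%:Z (rho i') = cut_pos N a j%:Z (rho i) + 1.
  move=> /avoid nz; have {}nz : cut_pos N a j%:Z (rho i') <> 0 by move/pos_eq0.
  have b' := cut_pos_bounds a N0 j%:Z (rho i'); have b := cut_pos_bounds a N0 j%:Z (rho i).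
  suff : cut_pos N a j%:Z (rho i') - 1 = cut_pos N a j%:Z (rho i) by lia.
  apply: (@eqmodz_small N%:Z); [lia|lia|].
  rewrite /cut_pos modz_mod -modzDml modz_mod modzDml.
  by move/eqmodzP: next => [q ->]; apply/eqmodzP; exists q; lia.
split.
- by move=> e; have := pos_next n.+1; rewrite e; lia.
- case=> // j jn; rewrite !cut_mx_ext; congr Posz; congr nat_of_bool.
  have /avoid nz : (0 < j.+1 <= n.+1)%N by lia.
  have : cut_pos N a j%:Z (a (j%:Z + 1)) <> cut_pos N a j%:Z (rho i').
    rewrite (_ : j%:Z + 1 = j.+1%:Z); last lia.
    by move=> /eqP; rewrite cut_pos_eq => /eqP.
  by rewrite /cut_level pos_next; lia.
- by apply/cut_mx_prec; rewrite -!cut_pos_last pos_next; lia.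
Qed.

End CutMatrix.

(** * Sufficiency *)

(** Counting backwards along [C] from a base point, so that [C] becomes
    subtraction of 1. *)
Lemma cyclic_coordinate (S : finType) (C : {perm S}) (b : S) :
  transitive_cyclic C ->
  exists (f : S -> 'I_#|S|) (g : 'I_#|S| -> S),
    [/\ cancel f g, cancel g f & forall x, f (C x) = ord_predp #|S| (f x)].
Proof.
move=> hC; have S0 : (0 < #|S|)%N by apply/card_gt0P; exists b.
have expN : (C ^+ #|S| = 1)%g.
  apply/permP=> x; rewrite perm1 permX.
  have <- : #|porbit C x| = #|S| by rewrite hC cardsT.
  exact: iter_porbit.
pose g (i : 'I_#|S|) := ((C^-1 ^+ i)%g : {perm S}) b.
have g_pred i : g (ord_predp _ i) = C (g i).
  rewrite /g permE /= expg_mod ?expgVn ?expN ?invg1 //.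
  apply: (@perm_inj _ C^-1%g); rewrite permK -permM -expgVn -expgSr prednK;
    last by rewrite addn_gt0 S0 orbT.
  by rewrite expgD [(C^-1 ^+ #|S|)%g]expgVn expN invg1 mulg1 -expgVn.
have g_surj x : exists i, g i = x.
  have /porbitP[q e] : b \in porbit C x by rewrite hC.
  exists (Ordinal (ltn_pmod q S0)); rewrite /g /= expg_mod; last by rewrite expgVn expN invg1.
  by rewrite expgVn e permK.
have [f fK] := fin_all_exists g_surj.
have gK : cancel g f.
  by apply/bij_can_sym => //; apply: inj_card_bij (can_inj fK) _; rewrite card_ord.
by exists f, g; split=> // x; apply: (can_inj gK); rewrite g_pred !fK.
Qed.

Section Sufficiency.
Variables (d : Order.disp_t) (S : finTBOrderType d) (A : bd_data S).
Hypothesis hA : assoc_bd A.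
Hypothesis hcompat : compatible (fun x y : S => (x < y)%O) (bd_C0 A).
Hypothesis halpha : ((\top, \bot)%O : S * S) \notin bd_G2 A.
Variable k : int.
Hypothesis hk : bd_C A = perm_expz (bd_C0 A) k.

Let N := #|S|.
Let pos (x : S) : int := (rank (fun y : S => y) x)%:Z.

Let pos_bounds x : 0 <= pos x < N%:Z. Proof. exact: rank_bounds. Qed.
Let pos_inj : injective pos. Proof. by move=> x y [] /(rank_inj (@inj_id _)). Qed.
Let pos_mod_inj x y : (pos x = pos y %[mod N%:Z])%Z -> x = y.
Proof. exact: rank_mod_inj. Qed.
Let pos_lt x y : (pos x < pos y) = (x < y)%O.
Proof. by rewrite ltz_nat ltn_rank. Qed.
Let pos_C0 x : (pos (bd_C0 A x) = pos x + 1 %[mod N%:Z])%Z.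
Proof. exact: rank_compatible. Qed.
Let pos_C x : (pos (bd_C A x) = pos x + k %[mod N%:Z])%Z.
Proof. by rewrite hk (translation_expz pos_C0) mulr1. Qed.
Let pos_bot : pos \bot%O = 0.
Proof. by rewrite /pos rank_minimum // => y; rewrite le0x. Qed.

(** The upper ends of the pairs of [perm_graph (bd_C0 A)] outside [Gamma1]. *)
Definition cut_points : seq S :=
  [seq y <- enum S | (((bd_C0 A)^-1)%g y, y) \notin bd_G1 A].

Let n := size cut_points.

(** Column 0 is opened at the minimum, columns 1 to [n] at the successive cut
    points, and the pattern then recedes by [k] at each period.  In particular
    column [n.+1] is opened at [C^-1] of the minimum. *)
Definition cut_at (j : int) : int :=
  pos (nth \bot%O (\bot%O :: cut_points) `|(j %% n.+1)%Z|%N) - (j %/ n.+1)%Z * k.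

Lemma cut_at_shift j q : cut_at (j + q * n.+1%:Z) = cut_at j - q * k.
Proof. by rewrite /cut_at [j + _]addrC modzMDl divzMDl // mulrDl opprD addrA addrAC. Qed.

Lemma cut_at_small (j : nat) : (j <= n)%N ->
  cut_at j%:Z = pos (nth \bot%O (\bot%O :: cut_points) j).
Proof.
by move=> jn; rewrite /cut_at modz_small ?divz_small ?mul0r ?subr0 //; rewrite /= ?ltz_nat ?ltnS.
Qed.

Lemma cut_at0 : cut_at 0 = 0.
Proof. by rewrite (@cut_at_small 0). Qed.

Lemma cut_at_reaches y : exists J : nat, (cut_at J%:Z = pos y %[mod N%:Z])%Z.
Proof.
have [_ hC _ _ _] := hA.
have /porbitP[q /(congr1 pos) e] : \bot%O \in porbit (bd_C A) y by rewrite hC in_setT.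
exists (q * n.+1)%N; have := cut_at_shift 0 q%:Z; rewrite add0r cut_at0 PoszM => ->.
have /eqmodzP[t] := translation_expz pos_C q%:Z y; rewrite /= -e pos_bot => et.
by apply/eqmodzP; exists t; clear -et; lia.
Qed.

(** If the pair cut at column [n.+1] were in [Gamma1], then its image under [C],
    which is the pair (max, min), would be in [Gamma2]. *)
Lemma last_cut_mem y : (cut_at n.+1%:Z = pos y %[mod N%:Z])%Z -> y \in cut_points.
Proof.
have := cut_at_shift 0 1; rewrite add0r !mul1r cut_at0 => -> /eqmodzP[q eq].
rewrite mem_filter mem_enum andbT; apply/negP=> yG; case/negP: halpha.
have [_ _ _ _ <-] := hA; apply/imsetP; exists (((bd_C0 A)^-1)%g y, y) => //=.
have {eq} Cy : bd_C A y = \bot%O.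
  apply: pos_mod_inj; rewrite pos_C pos_bot; apply/eqmodzP; exists (- q); clear -eq; lia.
rewrite Cy; congr pair; set x := ((bd_C0 A)^-1)%g y; set z := bd_C A x.
have C0z : bd_C0 A z = \bot%O.
  have /eqmodzP[q1 e1] := pos_C0 z; have /eqmodzP[q2 e2] := pos_C x.
  have /eqmodzP[q3 e3] := pos_C0 x; have /eqmodzP[q4 e4] := pos_C y.
  rewrite permKV in e3; rewrite Cy in e4.
  apply: pos_mod_inj; apply/eqmodzP; exists (q1 + q2 - q3 - q4); rewrite e1 e2.
  have e5 : pos x + k = pos \bot%O - 1 - (q3 + q4) * N%:Z by lia.
  rewrite e5; lia.
apply/eqP; rewrite eq_le lex1 andbT leNgt; apply/negP=> zt.
by have [] := hcompat (ex_intro _ \top%O zt); rewrite C0z ltx0.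
Qed.

Lemma mem_G1_avoid x y : y = bd_C0 A x ->
  (x, y) \in bd_G1 A <->
  forall j : nat, (0 < j <= n.+1)%N -> (cut_at j%:Z <> pos y %[mod N%:Z])%Z.
Proof.
move=> yE; have -> : ((x, y) \in bd_G1 A) = (y \notin cut_points).
  by rewrite mem_filter mem_enum andbT negbK yE permK.
split=> [ny j /andP[j0]|avoid].
  rewrite leq_eqVlt => /orP[/eqP->|jn] e; first by rewrite last_cut_mem in ny.
  case/negP: ny; move: e; rewrite cut_at_small // => /pos_mod_inj <-.
  by case: j j0 jn => //= j _ jn; exact: mem_nth.
apply/negP=> yc; apply: (avoid (index y cut_points).+1).
  by rewrite /= ltnS ltnW // index_mem.
by rewrite cut_at_small ?index_mem //= nth_index.
Qed.

Lemma rotation_obtained : obtained_from_matrix (fun x y : S => (x < y)%O) A.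
Proof.
have [tC0 tC G1p G2p G12] := hA.
have [f [g [fK gK fC]]] := cyclic_coordinate \bot%O tC.
pose f2 (p : S * S) := (f p.1, f p.2).
have f_inj := can_inj fK; have g_inj := can_inj gK.
have f2_inj : injective f2 by move=> [x y] [x' y'] [/f_inj -> /f_inj ->].
have C0B_inj : injective (fun i => f (bd_C0 A (g i))).
  by move=> i i' /f_inj /perm_inj /g_inj.
pose C0B := perm C0B_inj.
pose B := BDData C0B (ord_predp #|S|) (f2 @: bd_G1 A) (f2 @: bd_G2 A).
pose rho i := pos (g i).
have gC i : g (ord_predp _ i) = bd_C A (g i) by rewrite -{1}[i]gK -fC fK.
have rho_inj : injective rho by move=> i i' /pos_inj /g_inj.
have rho_pred i : (rho (ord_predp _ i) = rho i + k %[mod N%:Z])%Z by rewrite /rho gC pos_C.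
have rho_bounds i : 0 <= rho i < N%:Z by exact: pos_bounds.
have reach i : exists J : nat, (cut_at J%:Z = rho i %[mod N%:Z])%Z by exact: cut_at_reaches.
pose m := cut_mx n cut_at rho.
have precE i i' : mx_prec m i i' <-> (g i < g i')%O.
  by rewrite -pos_lt; apply: (cut_mx_prec cut_at_shift rho_pred cut_at0).
exists n, m, B; split.
- exact: (cut_mx_cond_a cut_at_shift rho_pred).
- exact: (cut_mx_cond_b cut_at_shift rho_pred cut_at0).
- split=> //=.
  + move=> i; apply/setP=> i'; rewrite [RHS]inE; apply/porbitP.
    have /porbitP[q e] : g i' \in porbit (bd_C0 A) (g i) by rewrite tC0.
    exists q; apply: g_inj; rewrite e; elim: (q) => [|r IH]; first by rewrite !expg0 !perm1.
    by rewrite !expgSr !permM IH [C0B _]permE fK.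
  + move=> i [i' /precE lt]; have [lt1 cov] := hcompat (ex_intro _ (g i') lt).
    split; first by apply/precE; rewrite permE fK.
    move=> t /precE/cov[e|lt']; first by left; rewrite permE -e gK.
    by right; apply/precE; rewrite permE fK.
  + move=> i i'.
    have -> : ((i, i') \in f2 @: bd_G1 A) = ((g i, g i') \in bd_G1 A).
      by rewrite -[(i, i')](_ : f2 (g i, g i') = _) ?mem_imset // /f2 /= !gK.
    have graphE : ((i, i') \in perm_graph C0B) = (g i' == bd_C0 A (g i)).
      apply/imsetP/eqP=> [[t _ [-> ->]]|e]; first by rewrite permE fK.
      by exists i => //; rewrite permE -e gK.
    have P1E : g i' = bd_C0 A (g i) -> mx_P1 m i i' <-> (g i, g i') \in bd_G1 A.
      move=> e; rewrite (mem_G1_avoid e).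
      by apply: (cut_mx_P1 cut_at_shift rho_pred cut_at0) => //; rewrite /rho e pos_C0.
    rewrite graphE; split=> [h|[h /eqP e]]; last exact/P1E.
    have e : g i' = bd_C0 A (g i).
      by have /imsetP[t _ [-> ->]] := subsetP (proper_sub G1p) _ h.
    by split; [exact/P1E|exact/eqP].
  + rewrite -G12 -!imset_comp; apply: eq_imset => p; by rewrite /= /f2 /= !fC.
- exists f; split=> //=.
  + by exists g.
  + by move=> x y; rewrite precE !fK.
  + by split=> x; rewrite ?fC // permE fK.
Qed.

End Sufficiency.

(** * The characterization *)

Unset Implicit Arguments.
Local Open Scope order_scope.

(* [S : finTBOrderType d] is a nonempty finite totally ordered set, with
   minimal element [\bot] and maximal element [\top]. *)
Theorem theorem5p3 (d : Order.disp_t) (S : finTBOrderType d) (A : bd_data S)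
    (hA : assoc_bd A)
    (hcompat : compatible (fun x y : S => x < y) (bd_C0 A)) :
  obtained_from_matrix (fun x y : S => x < y) A <->
  ((\top, \bot) : S * S) \notin bd_G2 A /\
  (exists k : int, coprimez k (Posz #|S|) /\ bd_C A = perm_expz (bd_C0 A) k).
Proof.
split=> [hm|[halpha [k [_ hk]]]].
  have [_ hC _ _ _] := hA.
  by split; [exact: matrix_alpha0 | exact: matrix_rotation].
exact: (rotation_obtained hA hcompat halpha hk).
Qed.
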